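(* Assume that $L$ is an $m$-dimensional Lévy process and that $Y$ is a $d$-dimensional $L$-driven MCARMA process with autoregressive polynomial $\tilde P\in M_d(\mathbb{R}[z])$ and moving average polynomial $\tilde Q\in M_{d,m}(\mathbb{R}[z])$. Then there exist integers $p>q>0$ and matrix polynomials $$P(z)=z^p\mathbf{1}_m+A_1z^{p-1}+\ldots+A_p\in M_m(\mathbb{R}[z]),\qquad Q(z)=B_0+B_1z+\ldots+B_qz^q\in M_{d,m}(\mathbb{R}[z])$$ satisfying $\tilde P(z)^{-1}\tilde Q(z)=Q(z)P(z)^{-1}$ for all $z\in\mathbb{C}$, and $\det P(z)=0$ if and only if $\det\tilde P(z)=0$. Moreover, the process $Y$ has the state space representation $$dX(t)=\mathbf{A}X(t)\,dt+E_p\,dL(t),\qquad Y(t)=\underline{B}X(t),$$ where $$\mathbf{A}=\begin{bmatrix}0&\mathbf{1}_m&0&\cdots&0\\0&0&\mathbf{1}_m&\cdots&0\\\vdots&\vdots&\vdots&\ddots&\vdots\\0&0&0&\cdots&\mathbf{1}_m\\-A_p&-A_{p-1}&-A_{p-2}&\cdots&-A_1\end{bmatrix}\in M_{pm}(\mathbb{R}),\quad E_p=\begin{bmatrix}0\\0\\\vdots\\0\\\mathbf{1}_m\end{bmatrix}\in M_{pm,m}(\mathbb{R}),$$ $$\underline{B}=[B_0\ B_1\ \cdots\ B_{p-1}]\in M_{d,pm}(\mathbb{R}),\qquad B_j=0\ \text{ for } q+1\le j\le p-1.$$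
   Context: $L=(L(t))_{t\in\mathbb{R}}$ is a two-sided $\mathbb{R}^m$-valued Lévy process; $\mathbf{1}_n$ is the $n\times n$ identity matrix. Let $\tilde P(z)=z^{\tilde p}\mathbf{1}_d+\tilde A_1z^{\tilde p-1}+\ldots+\tilde A_{\tilde p}\in M_d(\mathbb{R}[z])$ and $\tilde Q(z)=\tilde B_0+\tilde B_1z+\ldots+\tilde B_{\tilde q}z^{\tilde q}\in M_{d,m}(\mathbb{R}[z])$ with $\tilde p>\tilde q$. A $d$-dimensional $L$-driven MCARMA (multivariate continuous-time autoregressive moving average) process with autoregressive polynomial $\tilde P$ and moving average polynomial $\tilde Q$ is a solution $Y$ of the formal differential equation $\tilde P(D)Y(t)=\tilde Q(D)DL(t)$, $D=d/dt$, $t\in\mathbb{R}$; this is given a rigorous meaning by defining $Y$ through the continuous-time state space model $$d\tilde X(t)=\tilde{\mathbf{A}}\tilde X(t)\,dt+\beta\,dL(t),\qquad Y(t)=C\tilde X(t),\quad t\in\mathbb{R},$$ with $$\tilde{\mathbf{A}}=\begin{pmatrix}0&\mathbf{1}_d&0&\ldots&0\\0&0&\mathbf{1}_d&\ddots&\vdots\\\vdots&&\ddots&\ddots&0\\0&\ldots&\ldots&0&\mathbf{1}_d\\-\tilde A_{\tilde p}&-\tilde A_{\tilde p-1}&\ldots&\ldots&-\tilde A_1\end{pmatrix}\in M_{\tilde pd}(\mathbb{R}),\quad C=(\mathbf{1}_d,0,\ldots,0)\in M_{d,\tilde pd}(\mathbb{R}),$$ $\beta=(\beta_1^T\ \cdots\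 \beta_{\tilde p}^T)^T\in M_{\tilde pd,m}(\mathbb{R})$, and $\beta_{\tilde p-j}=-1_{\{0,\ldots,\tilde q\}}(j)\big[\sum_{i=1}^{\tilde p-j-1}\tilde A_i\beta_{\tilde p-j-i}-\tilde B_j\big]$.
   Formalization: The state space representation of Y is claimed when, almost surely, X̃(0) lies in the span of the columns of β, Ãβ, Ã²β, …; without this it fails (P̃=z−a, Q̃=0, Y=e^{at}), and the condition is necessary. The identity P̃⁻¹Q̃=QP⁻¹ is stated where det P̃(z)≠0. *)

(* Defs.v *)
From HB Require Import structures.
From mathcomp Require Import all_boot all_order all_algebra.
From mathcomp Require Import complex.
From mathcomp Require Import all_classical all_reals all_analysis.

Set Implicit Arguments.
Unset Strict Implicit.
Unset Printing Implicit Defensive.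
Import Order.TTheory GRing.Theory Num.Theory.
Import numFieldNormedType.Exports.

Local Open Scope classical_set_scope.
Local Open Scope ring_scope.

(* A stochastic process indexed by the real line, with values in R^n, is a
   function X : R -> Omega -> 'cV[R]_n. *)

(* The Borel sigma-algebra of R^n, as the product sigma-algebra (this is how
   the library equips n.-tuple R). *)
Definition borel_cV (R : realType) (n : nat) : set (set 'cV[R]_n) :=
  g_sigma_preimage (fun (i : 'I_n) (x : 'cV[R]_n) => x i ord0 : R).

Definition random_vector (R : realType) (dsp : measure_display)
    (Omega : measurableType dsp) (n : nat) (X : Omega -> 'cV[R]_n) : Prop :=
  forall B, borel_cV B -> measurable (X @^-1` B).

Definition cadlag (R : realType) (n : nat) (x : R -> 'cV[R]_n) : Prop :=
  forall t, (x u @[u --> t^'+] --> x t) /\ cvg (x u @[u --> t^'-]).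

Record levy_process (R : realType) (dsp : measure_display)
    (Omega : measurableType dsp) (Pr : probability Omega R) (m : nat)
    (L : R -> Omega -> 'cV[R]_m) : Prop := {
  levy_random_vector : forall t, random_vector (L t) ;
  levy_start : {ae Pr, forall w, L 0 w = 0} ;
  levy_independent_increments :
    forall (n : nat) (t : nat -> R) (B : nat -> set 'cV[R]_m),
      (forall i, t i <= t i.+1) -> (forall i, borel_cV (B i)) ->
      Pr (\bigcap_(i in `I_n) [set w | B i (L (t i.+1) w - L (t i) w)])
      = (\prod_(i < n) Pr [set w | B i (L (t i.+1) w - L (t i) w)%R])%E ;
  levy_stationary_increments :
    forall (s t h : R) (B : set 'cV[R]_m), borel_cV B ->
      Pr [set w | B (L (t + h) w - L (s + h) w)]
      = Pr [set w | B (L t w - L s w)] ;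
  levy_stochastic_continuity :
    forall (s e : R), 0 < e ->
      Pr [set w | e < `|L t w - L s w|] @[t --> s] --> 0%E ;
  levy_cadlag : {ae Pr, forall w, cadlag (L ^~ w)}
}.

(* X solves dX(t) = A X(t) dt + b dL(t), t in R.  The noise is additive, so
   the stochastic integral of the constant matrix b over ]s, t] is the
   increment b (L(t) - L(s)), and the equation is read pathwise in integrated
   form.  X is not required to be adapted and its value at 0 is arbitrary. *)
Record state_equation (R : realType) (dsp : measure_display)
    (Omega : measurableType dsp) (Pr : probability Omega R) (m n : nat)
    (L : R -> Omega -> 'cV[R]_m) (A : 'M[R]_n) (b : 'M[R]_(n, m))
    (X : R -> Omega -> 'cV[R]_n) : Prop := {
  state_random_vector : forall t, random_vector (X t) ;
  state_cadlag : {ae Pr, forall w, cadlag (X ^~ w)} ;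
  state_integral : {ae Pr, forall w, forall s t : R, s <= t ->
    X t w - X s w
    = \col_i (\int[lebesgue_measure]_(u in `[s, t]) (A *m X u w) i ord0)
      + b *m (L t w - L s w)}
}.

Definition state_space_model (R : realType) (dsp : measure_display)
    (Omega : measurableType dsp) (Pr : probability Omega R) (m n d : nat)
    (L : R -> Omega -> 'cV[R]_m) (A : 'M[R]_n) (b : 'M[R]_(n, m))
    (C : 'M[R]_(d, n)) (X : R -> Omega -> 'cV[R]_n)
    (Y : R -> Omega -> 'cV[R]_d) : Prop :=
  state_equation Pr L A b X /\ {ae Pr, forall w, forall t, Y t w = C *m X t w}.

(* x lies in the span of the columns of b, A b, A^2 b, ..., A^(n-1) b, the
   smallest A-invariant subspace that contains the range of b.  A solution of
   state_equation that is there at time 0 stays there; one that is not has a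
   component that solves dX = A X dt and that the noise does not drive.  For a
   strictly stationary solution with a stable A, for a solution with X(0) = 0,
   and for a controllable pair (A, b), the condition holds automatically. *)
Definition reachable (R : realType) (m n : nat) (A : 'M[R]_n)
    (b : 'M[R]_(n, m)) (x : 'cV[R]_n) : Prop :=
  exists u : 'I_n -> 'cV[R]_m, x = \sum_(k < n) (A ^+ k) *m b *m u k.

(* The coefficients A_1, ..., A_p of z^p 1_n + A_1 z^(p-1) + ... + A_p and
   B_0, ..., B_q of B_0 + B_1 z + ... + B_q z^q are given as functions on nat;
   values outside these ranges are not used. *)
Definition ar_poly (R : realType) (n p : nat) (A : nat -> 'M[R]_n)
    : 'M[{poly R}]_n :=
  ('X^p)%:M + \sum_(1 <= i < p.+1) 'X^(p - i) *: map_mx polyC (A i).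

Definition ma_poly (R : realType) (d m q : nat) (B : nat -> 'M[R]_(d, m))
    : 'M[{poly R}]_(d, m) :=
  \sum_(0 <= j < q.+1) 'X^j *: map_mx polyC (B j).

Definition mxpoly_eval (R : realType) (d m : nat) (M : 'M[{poly R}]_(d, m))
    (z : R[i]) : 'M[R[i]]_(d, m) :=
  map_mx (fun r : {poly R} => (map_poly (real_complex R) r).[z]) M.

Definition companion_mx (R : realType) (n p : nat) (A : nat -> 'M[R]_n)
    : 'M[R]_(\sum_(i < p) n) :=
  \mxblock_(i < p, j < p)
    (if i.+1 == p then - A (p - j)%N
     else if j == i.+1 :> nat then 1%:M else 0).

Definition first_block (R : realType) (d p : nat)
    : 'M[R]_(d, \sum_(i < p) d) :=
  \mxrow_(j < p) (if j == 0 :> nat then 1%:M else 0).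

Definition last_block (R : realType) (m p : nat)
    : 'M[R]_(\sum_(i < p) m, m) :=
  \mxcol_(i < p) (if i.+1 == p then 1%:M else 0 : 'M[R]_m).

Definition coef_row (R : realType) (d m p : nat) (B : nat -> 'M[R]_(d, m))
    : 'M[R]_(d, \sum_(j < p) m) :=
  \mxrow_(j < p) B j.

Section InputCoefficients.
Variables (R : realType) (d m p q : nat).
Variables (A : nat -> 'M[R]_d) (B : nat -> 'M[R]_(d, m)).

(* [:: beta_k; ...; beta_1]; the recursion is input_coefE below. *)
Fixpoint input_coef_rev (k : nat) : seq 'M[R]_(d, m) :=
  if k is k'.+1 then
    let s := input_coef_rev k' in
    (if (p - k <= q)%N
     then B (p - k)%N - \sum_(0 <= i < k') A i.+1 *m nth 0 s i
     else 0) :: s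
  else [::].

Definition input_coef (k : nat) : 'M[R]_(d, m) := head 0 (input_coef_rev k).

Lemma nth_input_coef_rev (k i : nat) :
  nth 0 (input_coef_rev k) i = input_coef (k - i)%N.
Proof.
elim: k i => [|k IHk] [|i] //.
by rewrite subSS -IHk.
Qed.

Lemma input_coefE (j : nat) : (j < p)%N ->
  input_coef (p - j) =
    - (if (j <= q)%N
       then \sum_(1 <= i < p - j) A i *m input_coef (p - j - i) - B j
       else 0).
Proof.
move=> jp; have pjp : (p - (p - j) = j)%N by rewrite subKn // ltnW.
case k_eq: (p - j)%N (subn_gt0 j p) => [|k]; rewrite jp // => _.
rewrite /input_coef /= -k_eq pjp; case: ifP => _; last by rewrite oppr0.
rewrite opprB; congr (_ - _); rewrite k_eq big_add1 /=.
by apply: eq_bigr => i _; rewrite nth_input_coef_rev subSS.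
Qed.

Definition input_mx : 'M[R]_(\sum_(i < p) d, m) :=
  \mxcol_(i < p) input_coef i.+1.

End InputCoefficients.

(* Y is the MCARMA process with autoregressive polynomial ar_poly p A and
   moving average polynomial ma_poly q B, and X is its state process. *)
Definition mcarma (R : realType) (dsp : measure_display)
    (Omega : measurableType dsp) (Pr : probability Omega R) (m d p q : nat)
    (L : R -> Omega -> 'cV[R]_m) (A : nat -> 'M[R]_d)
    (B : nat -> 'M[R]_(d, m)) (X : R -> Omega -> 'cV[R]_(\sum_(i < p) d))
    (Y : R -> Omega -> 'cV[R]_d) : Prop :=
  state_space_model Pr L (companion_mx p A) (input_mx p q A B)
    (first_block R d p) X Y.

(* Main.v *)
Require Import Defs.
From HB Require Import structures.
From mathcomp Require Import all_boot all_order all_algebra.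
From mathcomp Require Import complex.
From mathcomp Require Import all_classical all_reals all_analysis.
From mathcomp Require Import measurable_realfun zify ring lra.

Set Implicit Arguments.
Unset Strict Implicit.
Unset Printing Implicit Defensive.
Import Order.TTheory GRing.Theory Num.Theory.
Import numFieldNormedType.Exports.

Local Open Scope classical_set_scope.
Local Open Scope ring_scope.

(* Let f be the square of the characteristic polynomial of the companion matrix
   A~ of P~, and p its degree.  One can take P(z) = f(z) 1_m: it vanishes where
   det P~ does, and f(z) (z - A~)^-1 beta is a polynomial in z, with
   coefficients T_0, ..., T_(p-1) given by Horner's scheme for f(A~) beta = 0.
   Then Q(z) = sum_j z^j C T_j = f(z) C (z - A~)^-1 beta = f(z) P~(z)^-1 Q~(z).
   Squaring gives p >= 2 even for a scalar P~ of degree 1, so that q = p - 1 is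
   positive.  The matrix T = [T_0 ... T_(p-1)] intertwines the two state space
   models: T A = A~ T, T E_p = beta and C T = B.  The initial state X~(0) is
   reachable, so it is T x for a vector x that depends linearly on it.  The
   solution X of the new state equation started at x satisfies T X = X~, as T X
   and X~ solve the same equation, and Y = C X~ = C T X = B X.

   The state equations are solved pathwise.  The paths of L are only cadlag, so
   the calculus is that of continuous functions with a right derivative. *)

(** * Matrix polynomials and block companion matrices *)

Definition block_companion (K : pzRingType) (n p : nat) (A : nat -> 'M[K]_n)
    : 'M[K]_(\sum_(i < p) n) :=
  \mxblock_(i < p, j < p)
    (if i.+1 == p then - A (p - j)%N
     else if j == i.+1 :> nat then 1%:M else 0).

Lemma map_block_companion (K K' : pzRingType) (f : {rmorphism K -> K'})
    (n p : nat) (A : nat -> 'M[K]_n) :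
  map_mx f (block_companion p A) = block_companion p (fun i => map_mx f (A i)).
Proof.
apply/matrixP => k l; rewrite !mxE.
case: ifP => _; first by rewrite !mxE rmorphN.
by case: ifP => _; rewrite !mxE ?rmorph0 ?rmorph_nat.
Qed.

Lemma block_companion_mul_col (K : pzRingType) (n p k : nat)
    (A : nat -> 'M[K]_n) (x : nat -> 'M[K]_(n, k)) :
  block_companion p A *m \mxcol_(i < p) x i =
  \mxcol_(i < p) (if i.+1 == p then - \sum_(j < p) A (p - j)%N *m x j
                  else x i.+1).
Proof.
rewrite mul_mxblock_mxrow; apply: eq_mxcol => i.
case: ifPn => ip.
  by rewrite -sumrN; apply: eq_bigr => j _; rewrite mulNmx.
have ip' : (i.+1 < p)%N by rewrite ltn_neqAle ip ltn_ord.
rewrite (bigD1 (Ordinal ip')) //= eqxx mul1mx big1 ?addr0 // => j ji.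
rewrite ifN ?mul0mx //; apply: contra ji => /eqP ji; exact/eqP/val_inj.
Qed.

Lemma row_mul_block_companion (K : pzRingType) (n p k : nat)
    (A : nat -> 'M[K]_n) (x : nat -> 'M[K]_(k, n)) :
  \mxrow_(i < p) x i *m block_companion p A =
  \mxrow_(j < p) ((if j == 0 :> nat then 0 else x j.-1)
                  - x p.-1 *m A (p - j)%N).
Proof.
rewrite mul_mxrow_mxblock; apply: eq_mxrow => j.
have p0 : (0 < p)%N by apply: leq_ltn_trans (ltn_ord j).
have pp : (p.-1 < p)%N by rewrite prednK.
rewrite (bigD1 (Ordinal pp)) //= prednK // eqxx mulmxN addrC; congr (_ - _).
case: eqP => [j0|/eqP j0].
  apply: big1 => i ip; rewrite ifN ?j0 ?mulmx0 //.
  by rewrite -(inj_eq val_inj) /= in ip; rewrite -[p in _ == p]prednK // eqSS.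
have jp : (j.-1 < p)%N by rewrite (leq_ltn_trans (leq_pred _)).
have jE : j.-1.+1 = j :> nat by rewrite prednK ?lt0n.
rewrite (bigD1 (Ordinal jp)) /=; last first.
  by rewrite -(inj_eq val_inj) /= -eqSS jE prednK // ltn_eqF.
rewrite jE ltn_eqF // eqxx mulmx1 big1 ?addr0 // => i /andP[ip ij].
rewrite -!(inj_eq val_inj) /= in ip ij.
rewrite ifN -1?[p in _ == p]prednK ?eqSS // ifN ?mulmx0 //.
by rewrite -jE eqSS eq_sym.
Qed.

Lemma sum_ord_predS (V : nmodType) (p : nat) (F : nat -> V) : (0 < p)%N ->
  \sum_(j < p) F j = F 0%N + \sum_(j < p.-1) F j.+1.
Proof. by case: p => // p _; rewrite big_ord_recl. Qed.

Definition eval_ar (K : comNzRingType) (n p : nat) (A : nat -> 'M[K]_n)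
    (z : K) : 'M[K]_n :=
  (z ^+ p)%:M + \sum_(j < p) z ^+ j *: A (p - j)%N.

(* A left eigenvector of the block companion matrix is determined by its last
   block y, by Horner's scheme, and the last step of the scheme says that
   y P(z) = 0. *)
Lemma det_eval_ar_eq0 (K : fieldType) (n p : nat) (A : nat -> 'M[K]_n) (z : K) :
  (0 < p)%N ->
  (\det (eval_ar p A z) == 0) = root (char_poly (block_companion p A)) z.
Proof.
move=> p0; rewrite -eigenvalue_root_char; apply/det0P/eigenvalueP.
  move=> [y y0 yP].
  pose h (j : nat) : 'rV[K]_n :=
    z ^+ (p.-1 - j) *: y
    + \sum_(k < p.-1 - j) z ^+ k *: (y *m A (p.-1 - j - k)%N).
  have hS j : (0 < j < p)%N -> h j.-1 = z *: h j + y *m A (p - j)%N.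
    move=> /andP[j0 jp]; rewrite /h.
    have -> : (p.-1 - j.-1 = (p.-1 - j).+1)%N by lia.
    rewrite exprS -scalerA scalerDr -addrA; congr (_ + _).
    rewrite big_ord_recl /= expr0 scale1r addrC; congr (_ + _).
      by congr (_ *m A _); lia.
    rewrite scaler_sumr; apply: eq_bigr => k _; rewrite scalerA -exprS.
    by rewrite /bump /= add1n subSS.
  have hp : h p.-1 = y by rewrite /h subnn big_ord0 addr0 expr0 scale1r.
  have h0 : 0 = z *: h 0%N + y *m A p.
    rewrite -yP /eval_ar mulmxDr mul_mx_scalar mulmx_sumr.
    under eq_bigr => j _ do rewrite -scalemxAr.
    rewrite /h subn0.
    rewrite scalerDr scalerA -exprS prednK // -addrA; congr (_ + _).
    rewrite (sum_ord_predS (fun j => z ^+ j *: (_ *m A (p - j)%N)) p0).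
    rewrite expr0 scale1r subn0 addrC.
    congr (_ + _); rewrite scaler_sumr; apply: eq_bigr => k _.
    by rewrite scalerA -exprS; congr (_ *: (_ *m A _)); lia.
  exists (\mxrow_(i < p) h i).
    rewrite row_mul_block_companion hp.
    have -> : z *: (\mxrow_(i < p) h i) = \mxrow_(i < p) (z *: h i).
      by apply/matrixP => a b; rewrite !mxE.
    apply: eq_mxrow => j; case: eqP => [->|/eqP j0].
      by rewrite sub0r subn0; apply/eqP; rewrite eq_sym -addr_eq0 -h0.
    by rewrite hS ?addrK // lt0n j0 /=.
  have pp : (p.-1 < p)%N by rewrite prednK.
  apply: contra_neq y0 => /(congr1 (fun v => submxrow v (Ordinal pp))).
  by rewrite mxrowK /= hp submxrow0.
move=> [v vA v0].
pose h (j : nat) : 'rV[K]_n :=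
  if insub j is Some i then submxrow v (i : 'I_p) else 0.
have hE (i : 'I_p) : h i = submxrow v i by rewrite /h valK.
have vE : v = \mxrow_(i < p) h i.
  by rewrite -[LHS]submxrowK; apply: eq_mxrow => i; rewrite hE.
have hS j : (j < p)%N ->
    (if j == 0%N then 0 else h j.-1) = z *: h j + h p.-1 *m A (p - j)%N.
  move=> jp; move: vA; rewrite vE row_mul_block_companion.
  have -> : z *: (\mxrow_(i < p) h i) = \mxrow_(i < p) (z *: h i).
    by apply/matrixP => a b; rewrite !mxE.
  by move=> /eq_mxrowP/(_ (Ordinal jp)) /= <-; rewrite subrK.
have down k : (k < p)%N -> h (p.-1 - k)%N =
    z ^+ k *: h p.-1 + \sum_(l < k) z ^+ l *: (h p.-1 *m A (k - l)%N).
  elim: k => [|k IH] kp.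
    by rewrite subn0 big_ord0 addr0 expr0 scale1r.
  have := hS (p.-1 - k)%N; rewrite ifN; last by lia.
  have -> : (p.-1 - k).-1 = (p.-1 - k.+1)%N by lia.
  move=> ->; last by lia.
  rewrite IH; last by lia.
  rewrite scalerDr scalerA -exprS -addrA; congr (_ + _).
  rewrite big_ord_recl /= expr0 scale1r addrC; congr (_ + _).
    by congr (_ *m A _); lia.
  rewrite scaler_sumr; apply: eq_bigr => l _.
  by rewrite scalerA -exprS /bump /= add1n subSS.
exists (h p.-1).
  apply: contra_neq v0 => y0; rewrite vE -mxrow0; apply: eq_mxrow => i.
  have -> : i = (p.-1 - (p.-1 - i))%N :> nat by have := ltn_ord i; lia.
  rewrite down; last by have := ltn_ord i; lia.
  by rewrite y0 scaler0 add0r big1 // => l _; rewrite mul0mx scaler0.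
have := hS 0%N p0; rewrite eqxx subn0 => ->.
have := down p.-1; rewrite subnn => ->; last by rewrite prednK.
rewrite /eval_ar mulmxDr mul_mx_scalar mulmx_sumr.
under eq_bigr => j _ do rewrite -scalemxAr.
rewrite scalerDr scalerA -exprS prednK // -addrA; congr (_ + _).
rewrite (sum_ord_predS (fun j => z ^+ j *: (_ *m A (p - j)%N)) p0).
rewrite expr0 scale1r subn0 addrC.
congr (_ + _); rewrite scaler_sumr; apply: eq_bigr => k _.
by rewrite scalerA -exprS; congr (_ *: (_ *m A _)); lia.
Qed.

(* Eliminating the blocks x_1, ..., x_(p-1) from z x = A x + g b, where A is
   the block companion matrix, leaves P(z) x_0 = g Q(z). *)
Lemma eval_ar_companion_solution (K : comNzRingType) (n m p : nat)
    (A : nat -> 'M[K]_n) (b B x : nat -> 'M[K]_(n, m)) (z g : K) :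
  (forall i, (i.+1 < p)%N -> x i.+1 = z *: x i - g *: b i.+1) ->
  z *: x p.-1 - g *: b p = - \sum_(j < p) A (p - j)%N *m x j ->
  (forall l, (l < p)%N ->
     b (p - l)%N + \sum_(1 <= i < p - l) A i *m b (p - l - i)%N = B l) ->
  (0 < p)%N ->
  eval_ar p A z *m x 0%N = g *: \sum_(l < p) z ^+ l *: B l.
Proof.
move=> xS xp BE p0.
have xE i : (i < p)%N ->
    x i = z ^+ i *: x 0%N - g *: \sum_(l < i) z ^+ l *: b (i - l)%N.
  elim: i => [|i IH] ip; first by rewrite big_ord0 scaler0 subr0 expr0 scale1r.
  rewrite xS // IH 1?ltnW // scalerBr scalerA -exprS -addrA -opprD.
  congr (_ - _); rewrite big_ord_recl /= expr0 scale1r subn0 scalerDr addrC.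
  congr (_ + _); rewrite scalerA mulrC -scalerA scaler_sumr; congr (_ *: _).
  by apply: eq_bigr => l _; rewrite scalerA -exprS.
have last_step : z *: x p.-1 - g *: b p =
    z ^+ p *: x 0%N - g *: \sum_(l < p) z ^+ l *: b (p - l)%N.
  rewrite xE ?prednK // scalerBr scalerA -exprS prednK // -addrA -opprD.
  congr (_ - _).
  rewrite (sum_ord_predS (fun l => z ^+ l *: b (p - l)%N) p0).
  rewrite expr0 scale1r subn0 scalerDr addrC; congr (_ + _).
  rewrite scalerA mulrC -scalerA scaler_sumr; congr (_ *: _).
  by apply: eq_bigr => l _; rewrite scalerA -exprS; congr (_ *: b _); lia.
rewrite /eval_ar mulmxDl mul_scalar_mx mulmx_suml.
have -> : z ^+ p *: x 0%N = g *: \sum_(l < p) z ^+ l *: b (p - l)%N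
                          - \sum_(j < p) A (p - j)%N *m x j.
  by rewrite -xp last_step addrC subrK.
rewrite -addrA [- _ + _]addrC -sumrB.
have -> : \sum_(j < p) ((z ^+ j *: A (p - j)%N) *m x 0%N - A (p - j)%N *m x j)
    = g *: \sum_(j < p) \sum_(l < j) z ^+ l *: (A (p - j)%N *m b (j - l)%N).
  rewrite scaler_sumr; apply: eq_bigr => j _.
  rewrite (xE j) // mulmxBr -scalemxAl -scalemxAr opprB addrC subrK.
  rewrite -scalemxAr mulmx_sumr; congr (_ *: _).
  by apply: eq_bigr => l _; rewrite scalemxAr.
rewrite -scalerDr; congr (_ *: _).
transitivity (\sum_(l < p) (z ^+ l *: b (p - l)%N
    + \sum_(j < p | (l < j)%N) z ^+ l *: (A (p - j)%N *m b (j - l)%N))).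
  rewrite big_split; congr (_ + _).
  rewrite (exchange_big_dep xpredT) //=; apply: eq_bigr => j _.
  by rewrite (big_ord_widen p (fun l => z ^+ l *: (A (p - j)%N *m b (j - l)%N))
    (ltnW (ltn_ord j))).
apply: eq_bigr => l _; rewrite -BE // scalerDr; congr (_ + _).
rewrite scaler_sumr big_add1 -[in LHS](big_mkord (fun j => l < j)%N
  (fun j => z ^+ l *: (A (p - j)%N *m b (j - l)%N))).
rewrite -(big_nat_widenl l.+1 0 _ xpredT) // -[l.+1 in LHS]add0n big_addn.
rewrite big_nat_rev /= add0n subnS !big_mkord; apply: eq_bigr => i _.
by congr (_ *: (A _ *m b _)); have := ltn_ord i; lia.
Qed.

Lemma mxcol_nat (T : zmodType) (n k p : nat) (M : 'M[T]_(\sum_(i < p) n, k)) :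
  exists x : nat -> 'M[T]_(n, k), M = \mxcol_(i < p) x i.
Proof.
exists (fun i => if insub i is Some j then submxcol M (j : 'I_p) else 0).
by rewrite -[LHS]submxcolK; apply: eq_mxcol => i; rewrite valK.
Qed.

Lemma input_coef_conv (R : realType) (d m p q : nat) (A : nat -> 'M[R]_d)
    (B : nat -> 'M[R]_(d, m)) (l : nat) : (l < p)%N ->
  input_coef p q A B (p - l)
    + \sum_(1 <= i < p - l) A i *m input_coef p q A B (p - l - i)
  = if (l <= q)%N then B l else 0.
Proof.
have small k j : (q < p - k)%N -> (k <= p)%N -> (j <= k)%N ->
    input_coef p q A B j = 0.
  case: j => [|j] // qk kp jk.
  have -> : j.+1 = (p - (p - j.+1))%N by lia.
  rewrite input_coefE; last by lia.
  by rewrite ifN ?oppr0 //; lia.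
move=> lp; case: leqP => lq.
  by rewrite input_coefE // lq opprB subrK.
rewrite (small (p - l)%N) ?add0r ?big_nat; [|lia..].
apply: big1 => i /andP[i0 il]; rewrite (small (p - l)%N) ?mulmx0 //; lia.
Qed.

Lemma mxpoly_eval_ar (R : realType) (n p : nat) (A : nat -> 'M[R]_n)
    (z : R[i]) :
  mxpoly_eval (ar_poly p A) z =
  eval_ar p (fun i => map_mx (real_complex R) (A i)) z.
Proof.
apply/matrixP => i j; rewrite /mxpoly_eval /ar_poly /eval_ar !mxE.
rewrite !summxE rmorphD /= rmorph_sum /= !hornerE horner_sum; congr (_ + _).
  by rewrite rmorphMn /= map_polyXn hornerMn hornerXn.
rewrite big_add1 /= big_mkord (reindex_inj rev_ord_inj) /=.
apply: eq_bigr => k _.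
rewrite !mxE rmorphM /= map_polyXn map_polyC !hornerE.
by congr (z ^+ _ * (A _ i j)%:C%C); have := ltn_ord k; lia.
Qed.

Lemma mxpoly_eval_ma (R : realType) (d m q : nat) (B : nat -> 'M[R]_(d, m))
    (z : R[i]) :
  mxpoly_eval (ma_poly q B) z =
  \sum_(j < q.+1) z ^+ j *: map_mx (real_complex R) (B j).
Proof.
apply/matrixP => i j; rewrite /mxpoly_eval /ma_poly !mxE.
rewrite !summxE rmorph_sum /= horner_sum big_mkord; apply: eq_bigr => k _.
by rewrite !mxE rmorphM /= map_polyXn map_polyC !hornerE.
Qed.

Lemma annihilating_coef (R : comNzRingType) (n : nat) (A : 'M[R]_n)
    (g : {poly R}) :
  \sum_(i < size (g * char_poly A)) (g * char_poly A)`_i *: A ^+ i = 0.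
Proof.
case: n A => [|n] A; first by apply/matrixP => - [].
transitivity (horner_mx A (g * char_poly A)); last first.
  by rewrite rmorphM /= Cayley_Hamilton mulr0.
rewrite -[in RHS](coefK (g * _)) poly_def rmorph_sum /=.
by symmetry; under eq_bigr => i _ do rewrite linearZ rmorphXn /= horner_mx_X.
Qed.

Lemma mul_last_block (R : realType) (m n p : nat) (T : nat -> 'M[R]_(n, m)) :
  (0 < p)%N -> \mxrow_(j < p) T j *m last_block R m p = T p.-1.
Proof.
move=> p0; rewrite mul_mxrow_mxcol.
have pp : (p.-1 < p)%N by rewrite prednK.
rewrite (bigD1 (Ordinal pp)) //= prednK // eqxx mulmx1 big1 ?addr0 // => i ip.
rewrite ifN ?mulmx0 //; apply: contra ip => /eqP ip.
apply/eqP/val_inj => /=; lia.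
Qed.

Lemma first_block_mul (K : pzRingType) (n m p : nat) (x : nat -> 'M[K]_(n, m)) :
  (0 < p)%N ->
  \mxrow_(j < p) (if j == 0 :> nat then 1%:M else 0 : 'M[K]_n)
    *m \mxcol_(i < p) x i = x 0%N.
Proof.
move=> p0; rewrite mul_mxrow_mxcol.
rewrite (bigD1 (Ordinal p0)) //= mul1mx big1 ?addr0 // => i ip.
by rewrite ifN ?mul0mx.
Qed.

Lemma realize_right_factor (R : realType) (m d pt qt : nat)
    (At : nat -> 'M[R]_d) (Bt : nat -> 'M[R]_(d, m)) :
  (0 < m)%N -> (0 < d)%N -> (qt < pt)%N ->
  exists (p : nat) (A : nat -> 'M[R]_m) (B : nat -> 'M[R]_(d, m))
      (T : 'M[R]_(\sum_(i < pt) d, \sum_(i < p) m)),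
    [/\ (1 < p)%N,
        (forall z : R[i], \det (mxpoly_eval (ar_poly pt At) z) != 0 ->
           invmx (mxpoly_eval (ar_poly pt At) z)
             *m mxpoly_eval (ma_poly qt Bt) z
           = mxpoly_eval (ma_poly p.-1 B) z
             *m invmx (mxpoly_eval (ar_poly p A) z)),
        (forall z : R[i], \det (mxpoly_eval (ar_poly p A) z) = 0 <->
           \det (mxpoly_eval (ar_poly pt At) z) = 0) &
        [/\ T *m companion_mx p A = companion_mx pt At *m T,
            T *m last_block R m p = input_mx pt qt At Bt &
            first_block R d pt *m T = coef_row p B]].
Proof.
move=> m0 d0 qpt; have pt0 : (0 < pt)%N by apply: leq_ltn_trans qpt.
set At' := companion_mx pt At; set beta := input_mx pt qt At Bt.
pose c := char_poly At'; pose f := c * c; pose p := (size f).-1.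
have cmon : c \is monic by exact: char_poly_monic.
have fmon : f \is monic by rewrite monicMl.
have p1 : (1 < p)%N.
  rewrite /p size_monicM ?monic_neq0 // size_char_poly sum_nat_const card_ord.
  by have : (0 < pt * d)%N by [rewrite muln_gt0 pt0]; lia.
have sf : size f = p.+1 by rewrite /p prednK // size_poly_gt0 monic_neq0.
have p0 : (0 < p)%N by apply: ltnW.
pose T j : 'M[R]_(\sum_(i < pt) d, m) :=
  \sum_(i < p) f`_(j.+1 + i) *: (At' ^+ i *m beta).
have TE j : At' *m T j + f`_j *: beta =
    \sum_(i < p.+1) f`_(j + i) *: (At' ^+ i *m beta).
  rewrite big_ord_recl /= expr0 mul1mx addn0 addrC; congr (_ + _).
  rewrite mulmx_sumr; apply: eq_bigr => i _.
  by rewrite -scalemxAr mulmxA /bump /= add1n exprS addnS.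
have f_big i : (p < i)%N -> f`_i = 0 by move=> pi; rewrite nth_default // sf.
have TS j : T j = At' *m T j.+1 + f`_j.+1 *: beta.
  by rewrite TE big_ord_recr /= f_big ?scale0r ?addr0 //; lia.
have T0 : At' *m T 0%N + f`_0 *: beta = 0.
  rewrite TE -[RHS](mul0mx _ beta) -(annihilating_coef At' c) -/c -/f sf.
  by rewrite mulmx_suml; apply: eq_bigr => i _; rewrite scalemxAl.
have fp : f`_p = 1 by rewrite -[p]/(size f).-1 -lead_coefE (monicP fmon).
have Tp : T p.-1 = beta.
  rewrite /T prednK //.
  rewrite (sum_ord_predS (fun i => f`_(p + i) *: (At' ^+ i *m beta)) p0).
  rewrite [X in _ + X]big1 => [|i _]; last by rewrite f_big ?scale0r //; lia.
  have -> : f`_(p + 0) = 1 by rewrite addn0.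
  by rewrite addr0 expr0 mul1mx scale1r.
pose A i : 'M[R]_m := (f`_(p - i))%:M.
pose B j := first_block R d pt *m T j.
pose toC := real_complex R.
have evP z : mxpoly_eval (ar_poly p A) z = ((map_poly toC f).[z])%:M.
  rewrite mxpoly_eval_ar /eval_ar horner_coef size_map_poly sf big_ord_recr /=.
  rewrite coef_map /= fp rmorph1 mul1r raddfD /= raddf_sum /= addrC.
  congr (_ + _); apply: eq_bigr => j _.
  rewrite /A subKn 1?ltnW // map_scalar_mx /= scale_scalar_mx coef_map.
  by rewrite mulrC.
have detP z : \det (mxpoly_eval (ar_poly p A) z) = (map_poly toC f).[z] ^+ m.
  by rewrite evP det_scalar.
have detPt z : (\det (mxpoly_eval (ar_poly pt At) z) == 0)
    = ((map_poly toC f).[z] == 0).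
  rewrite mxpoly_eval_ar det_eval_ar_eq0 //.
  rewrite -(map_block_companion toC) -map_char_poly /= -/At' -/c.
  by rewrite rmorphM /= hornerM mulf_eq0 orbb.
pose S z := \sum_(j < p) z ^+ j *: map_mx toC (T j).
have SE z : map_mx toC At' *m S z =
    z *: S z - (map_poly toC f).[z] *: map_mx toC beta.
  rewrite horner_coef size_map_poly sf big_ord_recr /= coef_map /= fp rmorph1.
  rewrite mul1r scalerDl opprD addrCA addrC /S.
  rewrite mulmx_sumr (sum_ord_predS (fun j => map_mx toC At' *m
    (z ^+ j *: map_mx toC (T j))) p0).
  rewrite (sum_ord_predS (fun j => (map_poly toC f)`_j * z ^+ j) p0).
  have -> : \sum_(j < p) z ^+ j *: map_mx toC (T j) =
      \sum_(j < p.-1) z ^+ j *: map_mx toC (T j)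
      + z ^+ p.-1 *: map_mx toC beta.
    by rewrite -Tp -[in LHS](prednK p0) big_ord_recr.
  rewrite scalerDr scalerA -exprS prednK // addrK.
  rewrite expr0 scale1r mulr1 -map_mxM coef_map /=.
  have -> : At' *m T 0%N = - (f`_0 *: beta).
    by apply/eqP; rewrite -addr_eq0 T0.
  rewrite map_mxN map_mxZ scalerDl opprD [RHS]addrCA; congr (_ + _).
  rewrite scaler_sumr scaler_suml -sumrB; apply: eq_bigr => j _.
  have -> : z *: (z ^+ j *: map_mx toC (T j)) = z ^+ j.+1 *: map_mx toC (T j).
    by rewrite scalerA -exprS.
  rewrite -scalemxAr -map_mxM (TS j) map_mxD map_mxZ scalerDr.
  by rewrite coef_map /= scalerA [in RHS]mulrC addrK.
have PQ z : mxpoly_eval (ar_poly pt At) z *m mxpoly_eval (ma_poly p.-1 B) z =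
    (map_poly toC f).[z] *: mxpoly_eval (ma_poly qt Bt) z.
  have [x Sx] := mxcol_nat (S z).
  have -> : mxpoly_eval (ma_poly p.-1 B) z = x 0%N.
    rewrite mxpoly_eval_ma prednK //.
    rewrite -(first_block_mul x pt0) -Sx /S mulmx_sumr; apply: eq_bigr => j _.
    rewrite -scalemxAr /B map_mxM; congr (_ *: (_ *m _)).
    apply/matrixP => k l; rewrite !mxE.
    by case: ifP => _; rewrite !mxE ?rmorph0 ?rmorph_nat.
  rewrite mxpoly_eval_ar mxpoly_eval_ma.
  pose b i := map_mx toC (input_coef pt qt At Bt i).
  have bE : map_mx toC beta = \mxcol_(i < pt) b i.+1.
    by apply/matrixP => i j; rewrite !mxE.
  have := SE z; rewrite [map_mx toC At'](map_block_companion toC) Sx bE.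
  rewrite block_companion_mul_col.
  have -> : z *: (\mxcol_(i < pt) x i)
      - (map_poly toC f).[z] *: (\mxcol_(i < pt) b i.+1) =
      \mxcol_(i < pt) (z *: x i - (map_poly toC f).[z] *: b i.+1).
    by apply/matrixP => i j; rewrite !mxE.
  move=> /eq_mxcolP xE.
  rewrite (@eval_ar_companion_solution _ _ _ _ _ b
    (fun l => map_mx toC (if (l <= qt)%N then Bt l else 0)) x z
    (map_poly toC f).[z]) //.
  - congr (_ *: _).
    rewrite (big_ord_widen pt (fun l => z ^+ l *: map_mx toC (Bt l))) //.
    rewrite [RHS]big_mkcond /=; apply: eq_bigr => l _; rewrite ltnS.
    by case: ifP => //; rewrite map_mx0 scaler0.
  - by move=> i ip; have := xE (Ordinal (ltnW ip)); rewrite /= ltn_eqF // => ->.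
  - have pp : (pt.-1 < pt)%N by rewrite prednK.
    by have := xE (Ordinal pp); rewrite /= prednK // eqxx => ->.
  - move=> l lp; rewrite -(input_coef_conv qt At Bt lp) map_mxD.
    rewrite raddf_sum /=; congr (_ + _).
    by apply: eq_bigr => i _; rewrite map_mxM.
exists p, A, B, (\mxrow_(j < p) T j); split=> //.
- move=> z Pz; have fz : (map_poly toC f).[z] != 0 by rewrite -detPt.
  have Pzu : mxpoly_eval (ar_poly pt At) z \in unitmx by rewrite unitmxE unitfE.
  rewrite evP invmx_scalar mul_mx_scalar.
  apply: (can_inj (mulKmx Pzu)); rewrite mulKVmx // -scalemxAr PQ scalerA.
  by rewrite mulVf // scale1r.
- move=> z; rewrite detP; split=> /eqP fz; apply/eqP.
    by rewrite detPt; move: fz; rewrite expf_eq0 => /andP[].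
  by rewrite expf_eq0 m0 -detPt fz.
split.
- rewrite [companion_mx p A]/(block_companion p A) row_mul_block_companion.
  rewrite mul_mxrow; apply: eq_mxrow => j.
  rewrite Tp /A mul_mx_scalar subKn 1?ltnW //.
  case: eqP => [j0|/eqP j0].
    by rewrite j0 sub0r; apply/eqP; rewrite eq_sym -addr_eq0 T0.
  by rewrite TS prednK ?lt0n // addrK.
- by rewrite mul_last_block.
- by rewrite mul_mxrow.
Qed.

(** * Right derivatives *)

Definition rderiv (R : realType) (F f : R -> R) : Prop :=
  continuous F /\ forall t, (F (t + h) - F t) / h @[h --> 0^'+] --> f t.

Section RightDerivative.
Variable R : realType.
Implicit Types (F G f g : R -> R) (a b s t : R).

Lemma continuous_rlim F t : continuous F -> F (t + h) @[h --> 0^'+] --> F t.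
Proof.
move=> cF; have c0 : (fun h => F (t + h)) @ (0 : R) --> F t.
  rewrite -[in X in _ --> X](addr0 t).
  apply: (@continuous_comp _ _ _ (fun h => t + h) F 0); last exact: cF.
  by apply: cvgD; [exact: cvg_cst|exact: cvg_id].
exact: (cvg_at_right_filter c0).
Qed.

Lemma rderiv_cst c : rderiv (fun=> c : R) (fun=> 0).
Proof.
split=> [t|t]; first exact: cvg_cst.
by under eq_fun do rewrite subrr mul0r; exact: cvg_cst.
Qed.

Lemma rderivD F G f g : rderiv F f -> rderiv G g ->
  rderiv (fun t => F t + G t) (fun t => f t + g t).
Proof.
move=> [cF dF] [cG dG]; split=> [t|t].
  by apply: cvgD; [exact: cF|exact: cG].
rewrite (_ : (fun h => _) =
    (fun h => (F (t + h) - F t) / h + (G (t + h) - G t) / h)).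
  exact: cvgD (dF t) (dG t).
by apply/funext => h; rewrite -mulrDl; congr (_ / _); ring.
Qed.

Lemma rderivM F G f g : rderiv F f -> rderiv G g ->
  rderiv (fun t => F t * G t) (fun t => f t * G t + F t * g t).
Proof.
move=> [cF dF] [cG dG]; split=> [t|t].
  by apply: cvgM; [exact: cF|exact: cG].
rewrite (_ : (fun h => _) =
    (fun h => (F (t + h) - F t) / h * G t
              + F (t + h) * ((G (t + h) - G t) / h))).
  apply: cvgD; first by apply: cvgM; [exact: dF|exact: cvg_cst].
  by apply: cvgM; [exact: continuous_rlim|exact: dG].
by apply/funext => h; ring.
Qed.

Lemma eq_rderiv F G f g : F =1 G -> f =1 g -> rderiv F f -> rderiv G g.
Proof. by move=> /funext -> /funext ->. Qed.

Lemma rderivZ c F f :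
  rderiv F f -> rderiv (fun t => c * F t) (fun t => c * f t).
Proof.
move=> dF; apply: eq_rderiv (rderivM (rderiv_cst c) dF) => // t.
by rewrite mul0r add0r.
Qed.

Lemma rderivN F f : rderiv F f -> rderiv (fun t => - F t) (fun t => - f t).
Proof. by move=> /(rderivZ (-1)); apply: eq_rderiv => t; rewrite mulN1r. Qed.

Lemma rderiv_sum (I : Type) (r : seq I) (P : pred I) (F f : I -> R -> R) :
  (forall i, P i -> rderiv (F i) (f i)) ->
  rderiv (fun t => \sum_(i <- r | P i) F i t)
    (fun t => \sum_(i <- r | P i) f i t).
Proof.
move=> dF; elim: r => [|i r IH].
  by apply: eq_rderiv (rderiv_cst 0) => t; rewrite big_nil.
case Pi: (P i); last by apply: eq_rderiv IH => t; rewrite big_cons Pi.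
by apply: eq_rderiv (rderivD (dF _ Pi) IH) => t; rewrite big_cons Pi.
Qed.

Lemma is_derive_rderiv F f : (forall t, is_derive t 1 F (f t)) -> rderiv F f.
Proof.
move=> dF; split=> t; have [dFt fE] := dF t.
  exact/differentiable_continuous/derivable1_diffP.
rewrite -fE; apply: cvg_trans (cvg_dnbhs_at_right (l := 'D_1 F t) dFt).
apply: near_eq_cvg; near=> h => /=.
by rewrite [h%:A]mulr1 [t + h]addrC mulrC.
Unshelve. all: by end_near. Qed.

(* A minimum c < b of F(t) - s t over [a, b], where s is the slope of the chord,
   contradicts the right derivative -s < 0 at c (Rolle's argument). *)
Lemma rderiv0_le F a b : rderiv F (fun=> 0) -> a <= b -> F b <= F a.
Proof.
move=> [cF dF] ab; rewrite leNgt; apply/negP => Fab.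
have {}ab : a < b.
  by rewrite lt_neqAle ab andbT; apply/eqP => ab'; rewrite ab' ltxx in Fab.
pose s := (F b - F a) / (b - a).
have s0 : 0 < s by rewrite divr_gt0 // subr_gt0.
pose K t := F t - s * t.
have cK : continuous K.
  move=> t; apply: cvgB; first exact: cF.
  by apply: cvgM; [exact: cvg_cst|exact: cvg_id].
have Kab : K a = K b.
  by rewrite /K /s; field; rewrite subr_eq0 gt_eqF.
have [c cab cmin] : exists2 c, a <= c < b & forall t, a <= t <= b -> K c <= K t.
  have [c] := EVT_min (ltW ab) (continuous_subspaceT cK).
  rewrite in_itv /= => /andP[ac cb] cmin.
  have {}cmin t : a <= t <= b -> K c <= K t.
    by move=> tab; apply: cmin; rewrite in_itv.
  move: cb; rewrite le_eqVlt => /predU1P[cb|cb]; last by exists c; rewrite ?ac.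
  exists a => [|t /cmin]; first by rewrite lexx.
  by rewrite Kab -cb.
have /cvgrPdist_lt/(_ s s0) /= dFc := dF c.
near (0 : R)^'+ => h.
have h0 : 0 < h by near: h; exact: nbhs_right_gt.
have hb : c + h <= b.
  have : h <= b - c.
    by near: h; apply: nbhs_right_le; rewrite subr_gt0; case/andP: cab.
  by rewrite lerBrDr addrC.
have : `|0 - (F (c + h) - F c) / h| < s by near: h.
rewrite sub0r normrN => /(le_lt_trans (ler_norm _)); rewrite ltr_pdivrMr //.
have ach : a <= c + h <= b by rewrite hb andbT; case/andP: (cab) => ac _; lra.
by have := cmin _ ach; rewrite /K; lra.
Unshelve. all: by end_near. Qed.

Lemma rderiv0_cst F a b : rderiv F (fun=> 0) -> F a = F b.
Proof.
have H c d : rderiv F (fun=> 0) -> c <= d -> F c = F d.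
  move=> dF cd; apply/eqP; rewrite eq_le (rderiv0_le dF cd) andbT.
  rewrite -lerN2; apply: (@rderiv0_le (fun t => - F t)) => //.
  by apply: eq_rderiv (rderivN dF) => // t; rewrite oppr0.
move=> dF; have [ab|/ltW ba] := leP a b; first exact: H.
by symmetry; exact: H.
Qed.

End RightDerivative.

(** * Cadlag functions *)

Definition rcadlag (R : realType) (f : R -> R) : Prop :=
  forall t, (f u @[u --> t^'+] --> f t) /\ cvg (f u @[u --> t^'-]).

Section Cadlag.
Variable R : realType.
Implicit Types (f g : R -> R) (a b s t : R).

Lemma rcadlag_bounded f a b : rcadlag f ->
  exists M, forall u, a <= u <= b -> `|f u| <= M.
Proof.
move=> cf; have := segment_compact (a := a) (b := b).
move=> /compact_near_coveringP/(_ R (pinfty_nbhs R) (fun M u => `|f u| <= M)).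
move=> /(_ _) /= H.
have /filter_ex [M HM] :
    \forall M \near +oo, `[a, b] `<=` (fun u => `|f u| <= M).
  apply: H => t _.
  have [B HB] : exists B, \forall u \near t, `|f u| <= B.
    have [/cvgrPdist_lt/(_ 1 ltr01) fr /cvg_ex[l]] := cf t.
    move=> /cvgrPdist_lt/(_ 1 ltr01) fl.
    exists (`|f t| + `|l| + 1); near=> u.
    have frb : t < u -> `|f t - f u| < 1 by near: u; exact: fr.
    have flb : u < t -> `|l - f u| < 1 by near: u; exact: fl.
    have [ut|ut|->] := ltgtP u t.
    - have := ler_normB (l - f u) l; rewrite addrAC subrr add0r normrN.
      have := flb ut; have := normr_ge0 (f t); lra.
    - have := ler_normB (f t - f u) (f t); rewrite addrAC subrr add0r normrN.
      have := frb ut; have := normr_ge0 l; lra.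
    - by have := normr_ge0 l; lra.
  exists ([set u | `|f u| <= B], [set M | B <= M]) => /=.
    by split => //; exact: (nbhs_pinfty_ge (num_real B)).
  by move=> [u M] /= [uB BM]; exact: le_trans BM.
by exists M => u uab; apply: HM; rewrite /= in_itv.
Unshelve. all: by end_near. Qed.

Lemma right_continuous_measurable d (T : measurableType d) (f : R -> T -> R) :
  (forall t, measurable_fun setT (f t)) ->
  (forall w t, f u w @[u --> t^'+] --> f t w) ->
  measurable_fun setT (fun p : R * T => f p.1 p.2).
Proof.
move=> mf cf.
pose step (n : nat) (t : R) : R := (Num.floor (n.+1%:R * t) + 1)%:~R / n.+1%:R.
have step_gt n t : t < step n t.
  rewrite /step ltr_pdivlMr // mulrC.
  by have /andP[] := floor_itv (n.+1%:R * t).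
have step_le n t : step n t <= t + n.+1%:R^-1.
  rewrite /step ler_pdivrMr // mulrDl mulVf // intrD lerD2r mulrC.
  exact: floor_le.
have step_cvg t : step n t @[n --> \oo] --> t.
  apply: (@squeeze_cvgr _ _ _ _ (fun=> t) (fun n => t + n.+1%:R^-1)).
  - by near=> n; rewrite ltW //=.
  - exact: cvg_cst.
  - rewrite -[in X in _ --> X](addr0 t); apply: cvgD; first exact: cvg_cst.
    exact: cvg_harmonic.
apply: (measurable_fun_cvg (h := fun n p => f (step n p.1) p.2)).
  move=> n _ B mB; rewrite setTI.
  have -> : (fun p : R * T => f (step n p.1) p.2) @^-1` B =
      \bigcup_(k : int) ([set t | Num.floor (n.+1%:R * t) = k]
                         `*` (f ((k + 1)%:~R / n.+1%:R) @^-1` B)).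
    apply/seteqP; split=> [[t w] /= fB|[t w] /= [k _ [/= <-]]] //.
    by exists (Num.floor (n.+1%:R * t)).
  apply: countable_bigcupT_measurable => // k.
  apply: measurableX; last by rewrite -[X in measurable X]setTI; exact: mf.
  rewrite [X in measurable X](_ : _ =
    `[k%:~R / n.+1%:R, (k + 1)%:~R / n.+1%:R[%classic) //.
  apply/seteqP; split=> t;
    rewrite /= in_itv /= ler_pdivrMr // ltr_pdivlMr // mulrC.
    by move=> <-; exact: floor_itv.
  exact: floor_def.
move=> [t w] _ /=.
have /cvg_at_rightP := cf w t; apply; split => //.
Unshelve. all: by end_near. Qed.

Lemma rcadlag_measurable f : rcadlag f -> measurable_fun setT f.
Proof.
move=> cf.
have := @right_continuous_measurable _ R (fun t _ => f t).
move=> /(_ (fun=> measurable_cst _) (fun _ t => (cf t).1)) mf.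
exact: (measurable_fun_pair1 (f := fun p : R * R => f p.1) (0 : R) mf).
Qed.

Lemma rcadlag_integrable f a b : rcadlag f ->
  lebesgue_measure.-integrable `[a, b] (EFin \o f).
Proof.
move=> cf; apply: measurable_bounded_integrable => //.
- by rewrite /= lebesgue_measure_itv /=; case: ifP => // _; rewrite -EFinB ltry.
- exact: measurable_funS (rcadlag_measurable cf).
have [M HM] := rcadlag_bounded a b cf.
exists M; split; first exact: num_real.
move=> N MN t /=; rewrite in_itv /= => /HM HMt; exact: le_trans (ltW MN).
Qed.

End Cadlag.

Section Primitive.
Variable R : realType.
Implicit Types (F f g : R -> R) (a b c e s t u : R).
Local Notation mu := (@lebesgue_measure R).

Lemma Rintegral_itv_cat f s t u : rcadlag f -> s <= t -> t <= u ->
  \int[mu]_(x in `[s, u]) f x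
  = \int[mu]_(x in `[s, t]) f x + \int[mu]_(x in `[t, u]) f x.
Proof.
move=> cf st tu.
have := @Rintegral_itvB R f (BLeft s) (BRight u) t (rcadlag_integrable s u cf).
rewrite !bnd_simp => /(_ st tu) E.
rewrite -(@Rintegral_itv_obnd_cbnd R t) -?E 1?addrC ?subrK //.
apply: integrableS (rcadlag_integrable t u cf) => //.
by apply: subset_itvr; rewrite bnd_simp.
Qed.

Lemma Rintegral_itv_near f a b c e : rcadlag f -> a <= b ->
  (forall u, a <= u <= b -> `|f u - c| <= e) ->
  `|\int[mu]_(x in `[a, b]) f x - c * (b - a)| <= e * (b - a).
Proof.
move=> cf ab H.
have muab : fine (mu `[a, b]%classic) = b - a.
  rewrite lebesgue_measure_itv /= lte_fin; case: ifPn => //.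
  by rewrite -leNgt => ba; apply/eqP; rewrite eq_sym subr_eq0 eq_le ab ba.
have icst r : mu.-integrable `[a, b] (EFin \o (fun=> r)).
  apply: rcadlag_integrable => t.
  by split; [exact: cvg_cst|exact: is_cvg_cst].
have lo : (c - e) * (b - a) <= \int[mu]_(x in `[a, b]) f x.
  rewrite -muab -Rintegral_cst //; apply: le_Rintegral => //.
    exact: rcadlag_integrable.
  move=> x /=; rewrite in_itv /= => /H; rewrite ler_norml => /andP[]; lra.
have up : \int[mu]_(x in `[a, b]) f x <= (c + e) * (b - a).
  rewrite -muab -Rintegral_cst //; apply: le_Rintegral => //.
    exact: rcadlag_integrable.
  move=> x /=; rewrite in_itv /= => /H; rewrite ler_norml => /andP[]; lra.
move: lo up; move: (\int[mu]_(x in _) _) => I lo up.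
by clear icst muab H; rewrite ler_norml; apply/andP; split; lra.
Qed.

Definition primitive f t : R :=
  if 0 <= t then \int[mu]_(x in `[0, t]) f x else - \int[mu]_(x in `[t, 0]) f x.

Lemma primitiveB f s t : rcadlag f -> s <= t ->
  primitive f t - primitive f s = \int[mu]_(x in `[s, t]) f x.
Proof.
move=> cf st; rewrite /primitive; case: (leP 0 s) => s0.
  by rewrite (le_trans s0 st) (Rintegral_itv_cat cf s0 st); lra.
case: (leP 0 t) => t0.
  by rewrite (Rintegral_itv_cat cf (ltW s0) t0); lra.
by rewrite (Rintegral_itv_cat cf st (ltW t0)); lra.
Qed.

Lemma rderiv_primitive f : rcadlag f -> rderiv (primitive f) f.
Proof.
move=> cf; split=> t.
  have [M HM] := rcadlag_bounded (t - 1) (t + 1) cf.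
  have M0 : 0 <= M.
    have tt : t - 1 <= t <= t + 1 by apply/andP; split; lra.
    exact: le_trans (normr_ge0 _) (HM t tt).
  have lip u v : t - 1 <= u -> u <= v -> v <= t + 1 ->
      `|primitive f v - primitive f u| <= M * (v - u).
    move=> ut uv vt; rewrite primitiveB //.
    have := @Rintegral_itv_near f u v 0 M cf uv; rewrite mul0r subr0; apply.
    by move=> x /andP[ux xv]; rewrite subr0 HM //; apply/andP; split; lra.
  apply/cvgrPdist_lt => e e0.
  have d0 : 0 < Num.min 1 (e / (M + 1)).
    by rewrite lt_min ltr01 divr_gt0 //; lra.
  near=> u.
  have tu : `|t - u| < Num.min 1 (e / (M + 1)).
    by near: u; exists (Num.min 1 (e / (M + 1))).
  move: tu; rewrite lt_min => /andP[]; rewrite ltr_norml => /andP[tu1 tu2].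
  rewrite ltr_pdivlMr; last by lra.
  move=> tue; apply: le_lt_trans tue.
  apply: (@le_trans _ _ (M * `|t - u|)); last first.
    by rewrite mulrC ler_wpM2l // lerDl.
  have [ut|tu] := leP u t.
    by rewrite (@ger0_norm _ (t - u)) ?subr_ge0 //; apply: lip; lra.
  rewrite distrC (distrC t) (@gtr0_norm _ (u - t)) ?subr_gt0 //.
  by apply: lip; lra.
apply/cvgrPdist_le => e e0.
have [/cvgrPdist_le/(_ e e0) [r /= r0 fr] _] := cf t.
near=> h.
have h0 : 0 < h by near: h; exact: nbhs_right_gt.
have hr : h < r by near: h; exact: nbhs_right_lt.
rewrite primitiveB //; last by lra.
rewrite distrC -[f t](mulfK (lt0r_neq0 h0)) -mulrBl normrM normfV.
rewrite (gtr0_norm h0) ler_pdivrMr //.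
have := @Rintegral_itv_near f t (t + h) (f t) e cf.
rewrite [t + h - t]addrAC subrr add0r; apply; first by lra.
move=> u /andP[tu uth]; move: tu; rewrite le_eqVlt => /predU1P[<-|tu].
  by rewrite subrr normr0 ltW.
rewrite distrC; apply: fr => //=.
by rewrite distrC gtr0_norm ?subr_gt0 //; lra.
Unshelve. all: by end_near. Qed.

Lemma Rintegral_rderiv F f s t : rderiv F f -> rcadlag f -> s <= t ->
  \int[mu]_(x in `[s, t]) f x = F t - F s.
Proof.
move=> dF cf st; rewrite -primitiveB //.
have := @rderiv0_cst R (fun t => primitive f t + - F t) s t.
have d0 := rderivD (rderiv_primitive cf) (rderivN dF).
move=> /(_ _) E; suff : primitive f s + - F s = primitive f t + - F t by lra.
by apply: E; apply: eq_rderiv d0 => // x; rewrite subrr.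
Qed.

Lemma rcadlag_continuous f : continuous f -> rcadlag f.
Proof.
move=> cf t; split; first exact: cvg_at_right_filter (cf t).
by apply/cvg_ex; exists (f t); exact: cvg_at_left_filter (cf t).
Qed.

Lemma rcadlagD f g : rcadlag f -> rcadlag g -> rcadlag (fun t => f t + g t).
Proof.
move=> cf cg t; have [fr fl] := cf t; have [gr gl] := cg t.
by split; [exact: cvgD|exact: is_cvgD].
Qed.

Lemma rcadlagM f g : rcadlag f -> rcadlag g -> rcadlag (fun t => f t * g t).
Proof.
move=> cf cg t; have [fr fl] := cf t; have [gr gl] := cg t.
by split; [exact: cvgM|exact: is_cvgM].
Qed.

Lemma rcadlag_cst c : rcadlag (fun=> c).
Proof. by move=> t; split; [exact: cvg_cst|exact: is_cvg_cst]. Qed.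

Lemma rcadlag_sum (I : Type) (r : seq I) (P : pred I) (f : I -> R -> R) :
  (forall i, P i -> rcadlag (f i)) ->
  rcadlag (fun t => \sum_(i <- r | P i) f i t).
Proof.
move=> cf; elim: r => [|i r IH].
  have := rcadlag_cst (0 : R); congr rcadlag.
  by apply/funext => t; rewrite big_nil.
case Pi: (P i).
  have := rcadlagD (cf _ Pi) IH; congr rcadlag.
  by apply/funext => t; rewrite big_cons Pi.
by move: IH; congr rcadlag; apply/funext => t; rewrite big_cons Pi.
Qed.

End Primitive.

Lemma measurable_Rintegral_param (R : realType) d1 d2 (T1 : measurableType d1)
    (T2 : measurableType d2) (mu : {sigma_finite_measure set T1 -> \bar R})
    (D : set T1) (f : T1 * T2 -> R) :
  measurable D -> measurable_fun setT f ->
  measurable_fun setT (fun w => \int[mu]_(x in D) f (x, w)).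
Proof.
move=> mD mf.
pose g (p : T1 * T2) : \bar R := ((f p)%:E * (\1_D p.1)%:E)%E.
have mg : measurable_fun setT g.
  apply: emeasurable_funM; first exact/measurable_EFinP.
  apply/measurable_EFinP.
  by apply: (@measurableT_comp _ _ _ _ _ _ (\1_D : T1 -> R) setT fst).
rewrite /Rintegral; apply: measurableT_comp => //.
rewrite [X in measurable_fun _ X](_ : _ = (fun w =>
   fubini_G mu (g^\+)%E w - fubini_G mu (g^\-)%E w)%E).
  apply: emeasurable_funB; apply: measurable_fun_fubini_tonelli_G => //.
    exact: measurable_funepos.
  exact: measurable_funeneg.
apply/funext => w.
transitivity (\int[mu]_x g (x, w))%E; last first.
  by rewrite integralE; congr (_ - _)%E; apply: eq_integral => x _;
    rewrite ?funeposE ?funenegE.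
rewrite integral_mkcond; apply: eq_integral => x _.
by rewrite /g /= patchE indicE; case: ifP => xD; rewrite ?mule1 ?mule0.
Qed.

Lemma measurable_primitive (R : realType) d (T : measurableType d)
    (f : R -> T -> R) t :
  (forall t, measurable_fun setT (f t)) ->
  (forall w, rcadlag (f ^~ w)) ->
  measurable_fun setT (fun w => primitive (f ^~ w) t).
Proof.
move=> mf cf.
have mfp := right_continuous_measurable mf (fun w t => (cf w t).1).
have mint (D : set R) : measurable D ->
    measurable_fun setT (fun w => \int[lebesgue_measure]_(x in D) f x w).
  by move=> mD; exact: (measurable_Rintegral_param lebesgue_measure mD mfp).
rewrite /primitive; case: (0 <= t); first exact: mint.
by apply: measurable_funN; exact: mint.
Qed.

(** * Linear differential equations *)

Section MatrixExponential.
Variable R : realType.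
Implicit Types (a : nat -> R) (c t : R).

Definition egf a t : R := limn (pseries (fun k => a k / k`!%:R) t).

Lemma is_cvg_egf a M c t : 0 <= c -> (forall k, `|a k| <= M * c ^+ k) ->
  cvgn (pseries (fun k => a k / k`!%:R) t).
Proof.
move=> c0 ac; apply: normed_cvg.
have M0 : 0 <= M by have := ac 0%N; rewrite expr0 mulr1; apply: le_trans.
have ct0 : 0 <= c * `|t| by exact: mulr_ge0.
pose v : R^nat := M *: exp_coeff (c * `|t|).
apply: (@series_le_cvg R _ v).
- by move=> k; rewrite normr_ge0.
- by move=> k; rewrite /v fctE mulr_ge0 // exp_coeff_ge0.
- move=> k; rewrite /v fctE /exp_coeff /= -[_ *: _]/(_ * _).
  have k0 : 0 <= (k`!%:R : R)^-1 by rewrite invr_ge0.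
  rewrite !normrM exprMn (ger0_norm k0) normrX mulrAC !mulrA.
  by rewrite ler_wpM2r // ler_wpM2r // exprn_ge0.
apply: is_cvg_seriesZ; exact: is_cvg_series_exp_coeff.
Qed.

Lemma is_derive_egf a M c t : (forall k, `|a k| <= M * c ^+ k) -> 0 <= c ->
  is_derive t 1 (egf a) (egf (fun k => a k.+1) t).
Proof.
move=> ac c0.
have diffsE (b : nat -> R) :
    pseries_diffs (fun k => b k / k`!%:R) = fun k => b k.+1 / k`!%:R.
  apply/funext => k; rewrite /pseries_diffs factS natrM invfM mulrCA.
  by rewrite mulVKf // pnatr_eq0.
have shift (b : nat -> R) N : (forall k, `|b k| <= N * c ^+ k) ->
    forall k, `|b k.+1| <= N * c * c ^+ k.
  by move=> bc k; rewrite -mulrA -exprS.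
have := @pseries_snd_diffs R (fun k => a k / k`!%:R) (`|t| + 1) t.
rewrite !diffsE; apply.
- exact: is_cvg_egf c0 ac.
- exact: is_cvg_egf c0 (shift _ _ ac).
- exact: is_cvg_egf c0 (shift _ _ (shift _ _ ac)).
by rewrite (@ger0_norm _ (`|t| + 1)) ?ltrDl // addr_ge0.
Qed.

Lemma egf_sumM (I : finType) (b : I -> R) (u : I -> nat -> R) M c t :
  0 <= c -> (forall i k, `|u i k| <= M * c ^+ k) ->
  egf (fun k => \sum_i u i k * b i) t = \sum_i egf (u i) t * b i.
Proof.
move=> c0 uc; apply: cvg_lim => //.
have -> : pseries (fun k => (\sum_i u i k * b i) / k`!%:R) t =
    fun N => \sum_i pseries (fun k => u i k / k`!%:R) t N * b i.
  apply/funext => N; rewrite /pseries /series /=.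
  under [RHS]eq_bigr do rewrite mulr_suml.
  rewrite exchange_big; apply: eq_bigr => k _.
  by rewrite !mulr_suml; apply: eq_bigr => i _; ring.
apply: cvg_big => [|i _]; first exact: add_continuous.
by apply: cvgM; [exact: is_cvg_egf c0 (uc i)|exact: cvg_cst].
Qed.

Variables (n : nat) (A : 'M[R]_n).

Definition expmx t : 'M[R]_n := \matrix_(i, j) egf (fun k => (A ^+ k) i j) t.

Lemma mx_exp_base_ge0 : 0 <= \sum_i \sum_j `|A i j|.
Proof. by rewrite sumr_ge0 // => ? _; exact: sumr_ge0. Qed.

Lemma mx_exp_bound k i j :
  `|(A ^+ k) i j| <= 1 * (\sum_i \sum_j `|A i j|) ^+ k.
Proof.
rewrite mul1r; elim: k i j => [|k IH] i j.
  by rewrite !expr0 mxE; case: (i == j); rewrite ?normr1 ?normr0.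
rewrite exprS mxE (le_trans (ler_norm_sum _ _ _)) // exprS.
apply: (@le_trans _ _ (\sum_l `|A i l| * (\sum_i \sum_j `|A i j|) ^+ k)).
  by apply: ler_sum => l _; rewrite normrM ler_wpM2l.
rewrite -mulr_suml ler_wpM2r //.
  by rewrite exprn_ge0 // mx_exp_base_ge0.
rewrite [leRHS](bigD1 i) //= lerDl sumr_ge0 // => ? _; exact: sumr_ge0.
Qed.

Lemma expmx0 : expmx 0 = 1%:M.
Proof.
apply/matrixP => i j; rewrite mxE /egf; apply: lim_near_cst => //.
near=> N; rewrite /pseries /series /= big_mkord.
have -> : N = N.-1.+1 by rewrite prednK //; near: N; exact: nbhs_infty_gt.
rewrite big_ord_recl /= expr0 mulr1 fact0 divr1 big1 ?addr0 // => k _.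
by rewrite expr0n mulr0.
Unshelve. all: by end_near. Qed.

Lemma rderiv_expmx_entry i j :
  rderiv (fun t => expmx t i j) (egf (fun k => (A ^+ k.+1) i j)).
Proof.
apply: is_derive_rderiv => t; under eq_fun do rewrite mxE.
exact: is_derive_egf (fun k => mx_exp_bound k i j) mx_exp_base_ge0.
Qed.

Lemma rderiv_expmx i j :
  rderiv (fun t => expmx t i j) (fun t => (A *m expmx t) i j).
Proof.
apply: eq_rderiv (rderiv_expmx_entry i j) => // t.
under eq_fun do rewrite exprS mxE.
under eq_fun do under eq_bigr do rewrite mulrC.
rewrite (egf_sumM _ _ mx_exp_base_ge0 (fun l k => mx_exp_bound k l j)).
by rewrite mxE; apply: eq_bigr => l _; rewrite mxE mulrC.
Qed.

Lemma rderiv_expmx_r i j :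
  rderiv (fun t => expmx t i j) (fun t => (expmx t *m A) i j).
Proof.
apply: eq_rderiv (rderiv_expmx_entry i j) => // t.
under eq_fun do rewrite exprSr mxE.
rewrite (egf_sumM _ _ mx_exp_base_ge0 (fun l k => mx_exp_bound k i l)).
by rewrite mxE; apply: eq_bigr => l _; rewrite mxE.
Qed.

End MatrixExponential.

Definition mx_rderiv (R : realType) (n m : nat) (F f : R -> 'M[R]_(n, m)) :
    Prop :=
  forall i j, rderiv (fun t => F t i j) (fun t => f t i j).

Section MatrixRightDerivative.
Variable R : realType.

Lemma eq_mx_rderiv n m (F G f g : R -> 'M[R]_(n, m)) :
  F =1 G -> f =1 g -> mx_rderiv F f -> mx_rderiv G g.
Proof. by move=> /funext -> /funext ->. Qed.

Lemma mx_rderiv_cst n m (C : 'M[R]_(n, m)) : mx_rderiv (fun=> C) (fun=> 0).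
Proof.
by move=> i j; apply: eq_rderiv (rderiv_cst (C i j)) => // t; rewrite mxE.
Qed.

Lemma mx_rderivD n m (F G f g : R -> 'M[R]_(n, m)) :
  mx_rderiv F f -> mx_rderiv G g ->
  mx_rderiv (fun t => F t + G t) (fun t => f t + g t).
Proof.
move=> dF dG i j; apply: eq_rderiv (rderivD (dF i j) (dG i j)) => t;
  by rewrite mxE.
Qed.

Lemma mx_rderivN n m (F f : R -> 'M[R]_(n, m)) :
  mx_rderiv F f -> mx_rderiv (fun t => - F t) (fun t => - f t).
Proof.
by move=> dF i j; apply: eq_rderiv (rderivN (dF i j)) => t; rewrite mxE.
Qed.

Lemma mx_rderivM n k m (F f : R -> 'M[R]_(n, k)) (G g : R -> 'M[R]_(k, m)) :
  mx_rderiv F f -> mx_rderiv G g ->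
  mx_rderiv (fun t => F t *m G t) (fun t => f t *m G t + F t *m g t).
Proof.
move=> dF dG i j; have := rderiv_sum (index_enum 'I_k) (P := predT)
  (fun l _ => rderivM (dF i l) (dG l j)).
by apply: eq_rderiv => t; rewrite !mxE // -big_split.
Qed.

Lemma mx_rderivMl n k m (C : 'M[R]_(n, k)) (F f : R -> 'M[R]_(k, m)) :
  mx_rderiv F f -> mx_rderiv (fun t => C *m F t) (fun t => C *m f t).
Proof.
move=> dF; apply: eq_mx_rderiv (mx_rderivM (mx_rderiv_cst C) dF) => // t.
by rewrite mul0mx add0r.
Qed.

Lemma mx_rderiv0_cst n m (F : R -> 'M[R]_(n, m)) a b :
  mx_rderiv F (fun=> 0) -> F a = F b.
Proof.
move=> dF; apply/matrixP => i j.
apply: (@rderiv0_cst R (fun t => F t i j)).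
by apply: eq_rderiv (dF i j) => // t; rewrite mxE.
Qed.

Variables (n : nat) (A : 'M[R]_n).

Lemma expmxN_mul t : expmx (- A) t *m expmx A t = 1%:M.
Proof.
rewrite (@mx_rderiv0_cst _ _ (fun t => expmx (- A) t *m expmx A t) t 0).
  by rewrite !expmx0 mulmx1.
have := mx_rderivM (@rderiv_expmx_r R n (- A)) (rderiv_expmx A).
apply: eq_mx_rderiv => // s.
by rewrite mulmxN mulNmx mulmxA addNr.
Qed.

Lemma linear_ode_unique m (D : R -> 'M[R]_(n, m)) :
  mx_rderiv D (fun t => A *m D t) -> D 0 = 0 -> forall t, D t = 0.
Proof.
move=> dD D0 t; rewrite -[D t]mul1mx -(mulmx1C (expmxN_mul t)) -mulmxA.
rewrite (@mx_rderiv0_cst _ _ (fun t => expmx (- A) t *m D t) t 0).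
  by rewrite D0 !mulmx0.
apply: eq_mx_rderiv (mx_rderivM (@rderiv_expmx_r R n (- A)) dD) => // s.
by rewrite mulmxN mulNmx mulmxA addNr.
Qed.

Definition linear_ode_sol (v : R -> 'cV[R]_n) (t : R) : 'cV[R]_n :=
  expmx A t *m \col_i primitive (fun s => (expmx (- A) s *m v s) i ord0) t.

Lemma linear_ode_sol_rcadlag (v : R -> 'cV[R]_n) :
  (forall i, rcadlag (fun t => v t i ord0)) ->
  forall i, rcadlag (fun s => (expmx (- A) s *m v s) i ord0).
Proof.
move=> cv i; under eq_fun do rewrite mxE.
apply: rcadlag_sum => j _; apply: rcadlagM => //.
exact: rcadlag_continuous (rderiv_expmx (- A) i j).1.
Qed.

Lemma linear_ode_solP (v : R -> 'cV[R]_n) :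
  (forall i, rcadlag (fun t => v t i ord0)) ->
  mx_rderiv (linear_ode_sol v) (fun t => A *m linear_ode_sol v t + v t).
Proof.
move=> cv.
pose g t := \col_i primitive (fun s => (expmx (- A) s *m v s) i ord0) t.
have dg : mx_rderiv g (fun t => expmx (- A) t *m v t).
  move=> i j; rewrite ord1.
  apply: eq_rderiv (rderiv_primitive (linear_ode_sol_rcadlag cv i)) => // t.
  by rewrite mxE.
apply: eq_mx_rderiv (mx_rderivM (rderiv_expmx A) dg) => [//|t].
by rewrite !mulmxA (mulmx1C (expmxN_mul t)) mul1mx.
Qed.

Lemma linear_ode_sol0 (v : R -> 'cV[R]_n) : linear_ode_sol v 0 = 0.
Proof.
rewrite /linear_ode_sol [X in _ *m X](_ : _ = 0) ?mulmx0 //.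
apply/matrixP => i j; rewrite !mxE /primitive lexx set_itv1.
exact: Rintegral_set1.
Qed.

Lemma cvg_mxP (T : Type) (F : set_system T) (FF : Filter F) m
    (f : T -> 'M[R]_(n, m)) (l : 'M[R]_(n, m)) :
  f x @[x --> F] --> l <-> forall i j, f x i j @[x --> F] --> l i j.
Proof.
split=> [fl i j|fl].
  exact: (cvg_comp f (fun M : 'M[R]_(n, m) => M i j) fl
    (@coord_continuous R n m i j l)).
apply/cvg_mx_entourageP => E entE.
have : \forall x \near F, forall i j, (l i j, f x i j) \in E.
  apply: filter_forall => i; apply: filter_forall => j.
  have /cvg_app_entourageP := fl i j; move=> /(_ E entE); apply: filterS => x.
  by rewrite inE.
by [].
Qed.

Lemma cadlagP (x : R -> 'cV[R]_n) :
  cadlag x <-> forall i, rcadlag (fun t => x t i ord0).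
Proof.
split=> [cx i t|cx t].
  have [/cvg_mxP xr /cvg_ex[l /cvg_mxP xl]] := cx t.
  by split => //; apply/cvg_ex; exists (l i ord0); exact: xl.
split; first by apply/cvg_mxP => i j; rewrite ord1; exact: (cx i t).1.
apply/cvg_ex; exists (\col_i lim (x u i ord0 @[u --> t^'-])).
by apply/cvg_mxP => i j; rewrite ord1 mxE; exact: (cx i t).2.
Qed.

Lemma random_vectorP d (T : measurableType d) (X : T -> 'cV[R]_n) :
  random_vector X <-> forall i, measurable_fun setT (fun w => X w i ord0).
Proof.
split=> [mX i _ B mB|mX].
  rewrite setTI; apply: (mX [set x | B (x i ord0)]).
  apply: sub_sigma_algebra.
  rewrite -bigcup_seq; exists i; first by rewrite /= mem_index_enum.
  by exists B => //; rewrite setTI.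
rewrite /random_vector.
have : sigma_algebra setT [set B : set 'cV[R]_n | measurable (X @^-1` B)].
  split; first by rewrite /= preimage_set0.
    by move=> B mB; rewrite /= setTD preimage_setC; exact: measurableC.
  move=> F mF; rewrite /= preimage_bigcup.
  by apply: bigcup_measurable => k _; exact: mF.
move=> sX B; apply: (smallest_sub sX) => {}B.
rewrite -bigcup_seq => -[i _ [C mC <-]].
by rewrite /= setTI; rewrite -[X in measurable X]setTI; exact: mX.
Qed.

End MatrixRightDerivative.

(** * Transfer between state space models *)

Lemma random_vector_mulmx (R : realType) d (T : measurableType d) (k n : nat)
    (C : 'M[R]_(k, n)) (X : T -> 'cV[R]_n) :
  random_vector X -> random_vector (fun w => C *m X w).
Proof.
move=> /random_vectorP mX; apply/random_vectorP => i.
under eq_fun do rewrite mxE; apply: measurable_sum => j.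
by apply: measurable_funM => //; exact: mX.
Qed.

Lemma random_vectorD (R : realType) d (T : measurableType d) (n : nat)
    (X Y : T -> 'cV[R]_n) :
  random_vector X -> random_vector Y -> random_vector (fun w => X w + Y w).
Proof.
move=> /random_vectorP mX /random_vectorP mY; apply/random_vectorP => i.
by under eq_fun do rewrite mxE; exact: measurable_funD.
Qed.

Lemma cadlag_mulmx (R : realType) (k n : nat) (C : 'M[R]_(k, n))
    (x : R -> 'cV[R]_n) :
  cadlag x -> cadlag (fun t => C *m x t).
Proof.
move=> /cadlagP cx; apply/cadlagP => i.
under eq_fun do rewrite mxE; apply: rcadlag_sum => j _.
by apply: rcadlagM; [exact: rcadlag_cst|exact: cx].
Qed.

Lemma cadlagD (R : realType) (n : nat) (x y : R -> 'cV[R]_n) :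
  cadlag x -> cadlag y -> cadlag (fun t => x t + y t).
Proof.
move=> /cadlagP cx /cadlagP cy; apply/cadlagP => i.
by under eq_fun do rewrite mxE; exact: rcadlagD.
Qed.

Lemma mx_rderiv_cadlag (R : realType) (n : nat) (z f : R -> 'cV[R]_n) :
  mx_rderiv z f -> cadlag z.
Proof.
by move=> dz; apply/cadlagP => i; exact: rcadlag_continuous (dz i ord0).1.
Qed.

Lemma mx_rderiv_integral (R : realType) (n : nat) (z f : R -> 'cV[R]_n) s t :
  mx_rderiv z f -> cadlag f -> s <= t ->
  \col_i (\int[lebesgue_measure]_(u in `[s, t]) f u i ord0) = z t - z s.
Proof.
move=> dz /cadlagP cf st; apply/matrixP => i j; rewrite (ord1 j) !mxE.
exact: Rintegral_rderiv (dz i ord0) (cf i) st.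
Qed.

Lemma integral_mx_rderiv (R : realType) (n : nat) (z f : R -> 'cV[R]_n) :
  cadlag f ->
  (forall s t, s <= t ->
    z t - z s = \col_i (\int[lebesgue_measure]_(u in `[s, t]) f u i ord0)) ->
  mx_rderiv z f.
Proof.
move=> /cadlagP cf zE i j; rewrite ord1.
have d := rderivD (rderiv_cst (z 0 i ord0)) (rderiv_primitive (cf i)).
apply: eq_rderiv d => t; last by rewrite add0r.
have zE' a b : a <= b -> z b i ord0 - z a i ord0 =
    primitive (fun u => f u i ord0) b - primitive (fun u => f u i ord0) a.
  move=> ab; rewrite primitiveB //.
  by have /matrixP/(_ i ord0) := zE a b ab; rewrite !mxE.
have p0 : primitive (fun u => f u i ord0) 0 = 0.
  by rewrite /primitive lexx set_itv1 Rintegral_set1.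
have [t0|/ltW t0] := leP 0 t; have := zE' _ _ t0; rewrite p0; lra.
Qed.

Lemma random_vector_linear_ode_sol (R : realType) d (T : measurableType d)
    (n : nat) (A : 'M[R]_n) (V : R -> T -> 'cV[R]_n) t :
  (forall s, random_vector (V s)) -> (forall w, cadlag (V ^~ w)) ->
  random_vector (fun w => linear_ode_sol A (V ^~ w) t).
Proof.
move=> mV cV; apply: random_vector_mulmx; apply/random_vectorP => i.
under eq_fun do rewrite mxE.
apply: (@measurable_primitive R d T
  (fun s w => (expmx (- A) s *m V s w) i ord0)).
  move=> s; have /random_vectorP := random_vector_mulmx (expmx (- A) s) (mV s).
  by apply.
move=> w; apply: (@linear_ode_sol_rcadlag R n A (V ^~ w)).
exact/cadlagP.
Qed.

(* [pinvmx] solves equations between row vectors, hence the transpositions. *)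
Lemma reachable_range (R : realType) (m n k : nat) (A : 'M[R]_n)
    (b : 'M[R]_(n, m)) (A' : 'M[R]_k) (e : 'M[R]_(k, m)) (T : 'M[R]_(n, k)) x :
  T *m A' = A *m T -> T *m e = b -> reachable A b x ->
  T *m (pinvmx T^T)^T *m x = x.
Proof.
move=> TA Te [u xE].
have TAk i : T *m A' ^+ i = A ^+ i *m T.
  elim: i => [|i IH]; first by rewrite !expr0 mulmx1 mul1mx.
  by rewrite !exprS mulmxA TA -mulmxA IH mulmxA.
have xT : x = T *m \sum_(i < n) (A' ^+ i *m e *m u i).
  rewrite xE mulmx_sumr; apply: eq_bigr => i _.
  by rewrite -Te !mulmxA TAk.
have xsub : (x^T <= T^T)%MS.
  apply/submxP; exists (\sum_(i < n) (A' ^+ i *m e *m u i))^T.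
  by rewrite -trmx_mul -xT.
apply: trmx_inj; rewrite trmx_mul [(T *m _)^T]trmx_mul trmxK mulmxA.
by rewrite mulmxKpV.
Qed.

Lemma state_space_transfer (R : realType) (dsp : measure_display)
    (Omega : measurableType dsp) (Pr : probability Omega R) (m n k d : nat)
    (L : R -> Omega -> 'cV[R]_m) (A : 'M[R]_n) (b : 'M[R]_(n, m))
    (C : 'M[R]_(d, n)) (A' : 'M[R]_k) (e : 'M[R]_(k, m)) (B : 'M[R]_(d, k))
    (T : 'M[R]_(n, k)) (X : R -> Omega -> 'cV[R]_n)
    (Y : R -> Omega -> 'cV[R]_d) :
  T *m A' = A *m T -> T *m e = b -> C *m T = B ->
  (forall t, random_vector (L t)) -> {ae Pr, forall w, cadlag (L ^~ w)} ->
  state_space_model Pr L A b C X Y ->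
  {ae Pr, forall w, reachable A b (X 0 w)} ->
  exists X', state_space_model Pr L A' e B X' Y.
Proof.
move=> TA Te CT mL cL [[mX cX iX] YX] rX.
have [N [mN N0 cN]] := cL.
have FPr : Filter (nbhs (almost_everywhere Pr)) := ae_filter_ringOfSetsType Pr.
pose M := (pinvmx T^T)^T.
pose Lg t w : 'cV[R]_m := (\1_(~` N) w : R) *: (L t w - L 0 w).
have mLg t : random_vector (Lg t).
  apply/random_vectorP => i; rewrite /Lg; under eq_fun do rewrite !mxE.
  apply: measurable_funM.
    by apply: measurable_indic; exact: measurableC.
  have /random_vectorP/(_ i) mt := mL t; have /random_vectorP/(_ i) m0 := mL 0.
  exact: measurable_funB.
have LgE t w : ~ N w -> Lg t w = L t w - L 0 w.
  by move=> Nw; rewrite /Lg indicE mem_set // scale1r.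
have cLg w : cadlag (Lg ^~ w).
  apply/cadlagP => i; rewrite /Lg; under eq_fun do rewrite !mxE.
  rewrite indicE; case: (boolP (w \in ~` N)) => [/set_mem Nw|_].
    have /cadlagP cw : cadlag (L ^~ w) by apply: contrapT => /cN.
    apply: rcadlagM; first exact: rcadlag_cst.
    by apply: rcadlagD; [exact: cw|exact: rcadlag_cst].
  have := rcadlag_cst (0 : R); congr rcadlag.
  by apply/funext => t; rewrite mul0r.
pose V t w := M *m X 0 w + e *m Lg t w.
have mV t : random_vector (V t).
  by apply: random_vectorD; exact: random_vector_mulmx.
have cV w : cadlag (V ^~ w).
  apply: cadlagD; last exact: cadlag_mulmx.
  by apply/cadlagP => i; exact: rcadlag_cst.
pose Z t w := linear_ode_sol A' (V ^~ w) t.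
have dZ w : mx_rderiv (Z ^~ w) (fun t => A' *m Z t w + V t w).
  by apply: linear_ode_solP; exact/cadlagP.
pose X' t w := V t w + A' *m Z t w.
have cX' w : cadlag (X' ^~ w).
  apply: cadlagD => //; apply: cadlag_mulmx; exact: mx_rderiv_cadlag (dZ w).
have dAZ w : mx_rderiv (fun t => A' *m Z t w) (fun t => A' *m X' t w).
  by apply: eq_mx_rderiv (mx_rderivMl A' (dZ w)) => // t; rewrite addrC.
have V_incr s t w : ~ N w -> V t w - V s w = e *m (L t w - L s w).
  move=> Nw; rewrite /V !LgE // opprD addrACA subrr add0r -mulmxBr.
  by rewrite opprB addrA subrK.
have aeN : {ae Pr, forall w, ~ N w}.
  by exists N; split => // w /=; exact: contrapT.
exists X'; split; [split|].
- move=> t; apply: random_vectorD => //.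
  by apply: random_vector_mulmx; exact: random_vector_linear_ode_sol.
- by apply: aeW => w; exact: cX'.
- apply: filterS aeN => w Nw s t st.
  rewrite (mx_rderiv_integral (dAZ w) (cadlag_mulmx A' (cX' w)) st).
  rewrite -V_incr // /X' opprD addrACA addrC.
  by [].
have aeA := filterI (filterI aeN cX) (filterI (filterI iX YX) rX).
apply: (filterS _ (aeA FPr FPr FPr FPr)) => w [[Nw cXw] [[iXw YXw] rXw]] t.
have TX : T *m X' t w = X t w.
  pose U s := X s w - b *m (L s w - L 0 w).
  have dU : mx_rderiv U (fun s => A *m X s w).
    apply: integral_mx_rderiv; first exact: cadlag_mulmx.
    move=> r s rs; rewrite /U opprD addrACA -opprD -mulmxBr opprB addrA subrK.
    by rewrite (iXw _ _ rs) addrK.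
  have DE s : T *m X' s w - X s w = X 0 w + T *m (A' *m Z s w) - U s.
    have rM : T *m M *m X 0 w = X 0 w := reachable_range TA Te rXw.
    rewrite /X' /V /U 2!mulmxDr LgE // (mulmxA T M) rM (mulmxA T e) Te.
    by rewrite opprB [RHS]addrA; congr (_ - _); rewrite addrAC.
  apply/eqP; rewrite -subr_eq0; apply/eqP.
  apply: (@linear_ode_unique R n A _ (fun s => T *m X' s w - X s w));
    last first.
    rewrite DE /Z linear_ode_sol0 !mulmx0 addr0 /U.
    by rewrite !subrr mulmx0 subr0 subrr.
  have := mx_rderivD (mx_rderivD (mx_rderiv_cst (X 0 w))
    (mx_rderivMl T (dAZ w))) (mx_rderivN dU).
  apply: eq_mx_rderiv => s; first by rewrite DE.
  by rewrite add0r mulmxBr !mulmxA TA.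
by rewrite YXw -TX mulmxA CT.
Qed.

Theorem theorem3p2 (R : realType) (dsp : measure_display)
    (Omega : measurableType dsp) (Pr : probability Omega R)
    (m d pt qt : nat) (At : nat -> 'M[R]_d) (Bt : nat -> 'M[R]_(d, m))
    (L : R -> Omega -> 'cV[R]_m)
    (Xt : R -> Omega -> 'cV[R]_(\sum_(i < pt) d))
    (Y : R -> Omega -> 'cV[R]_d)
    (hm : (0 < m)%N) (hd : (0 < d)%N) (hpq : (qt < pt)%N)
    (hL : levy_process Pr L)
    (hY : mcarma Pr qt L At Bt Xt Y) :
  exists (p q : nat) (A : nat -> 'M[R]_m) (B : nat -> 'M[R]_(d, m)),
    [/\ (0 < q < p)%N,
        (forall z : R[i], \det (mxpoly_eval (ar_poly pt At) z) != 0 ->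
           invmx (mxpoly_eval (ar_poly pt At) z)
             *m mxpoly_eval (ma_poly qt Bt) z
           = mxpoly_eval (ma_poly q B) z
             *m invmx (mxpoly_eval (ar_poly p A) z)),
        (forall z : R[i], \det (mxpoly_eval (ar_poly p A) z) = 0 <->
           \det (mxpoly_eval (ar_poly pt At) z) = 0),
        (forall j, (q < j < p)%N -> B j = 0)
      & {ae Pr, forall w,
           reachable (companion_mx pt At) (input_mx pt qt At Bt) (Xt 0 w)} ->
        exists X : R -> Omega -> 'cV[R]_(\sum_(i < p) m),
          state_space_model Pr L (companion_mx p A) (last_block R m p)
            (coef_row p B) X Y].
Proof.
have [p [A [B [T [p1 PQ detP [TA TE CT]]]]]] :=
  realize_right_factor At Bt hm hd hpq.
exists p, p.-1, A, B; split=> //.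
- by apply/andP; split; lia.
- by move=> j; lia.
move=> rX; case: hL => mL _ _ _ _ cL.
exact: (state_space_transfer TA TE CT mL cL hY rX).
Qed.
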